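(* Let $A$ be a Banach algebra, $X$ a contractive Banach $A$-bimodule, and $D:A\to X$ a continuous derivation. Then there exists a unique weak*-weak* continuous derivation $\widetilde D:\mathcal F(A)\to\mathcal F_A(X)$ such that $\widetilde D\,\eta_A=\eta_X D$.
   Context: All modules are Banach modules; all maps are linear and norm-continuous. An $A$-bimodule $X$ is contractive if $\|a\cdot x\|\le\|a\|\|x\|$ and $\|x\cdot a\|\le\|a\|\|x\|$. A derivation $D$ from $A$ to an $A$-bimodule satisfies $D(ab)=a\cdot D(b)+D(a)\cdot b$. The dual $X^*$ is an $A$-bimodule via $(a\cdot\phi)(x)=\phi(x\cdot a)$, $(\phi\cdot a)(x)=\phi(a\cdot x)$. For an $A$-bimodule $E$, $\mathrm{WAP}_A(E)$ is the closed sub-bimodule of all $x\in E$ for which the orbit maps $A\to E$, $a\mapsto a\cdot x$ and $a\mapsto x\cdot a$ are both weakly compact. Put $\mathcal F_A(X)_*=\mathrm{WAP}_A(X^* )$ and $\mathcal F_A(X)=(\mathcal F_A(X)_* )^*$. Let $\eta_X:X\to\mathcal F_A(X)$ be the canonical embedding $X\to X^{**}$ followed by the adjoint of the inclusion $\mathrm{WAP}_A(X^* )\hookrightarrow X^*$. For $X=A$ write $\mathcal F(A)=\mathcal F_A(A)$ and $\mathcal F(A)_*=\mathrm{WAP}_A(A^* )$. $\mathcal F(A)$ carries the unique product for which the natural quotient map $A^{**}\to\mathcal F(A)$ is a homomorphism when $A^{**}$ has the first Arens product; this makes it a dual Banach algebra (multiplication is separately weak*-continuous) with predual $\mathcal F(A)_*$,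 and $\eta_A$ is a homomorphism with weak*-dense range. $\mathcal F_A(X)$ is a normal dual $\mathcal F(A)$-bimodule with predual $\mathcal F_A(X)_*$: its $\mathcal F(A)$-action is the one that is separately weak*-continuous in each variable and satisfies $\eta_A(a)\cdot\eta_X(x)=\eta_X(a\cdot x)$, $\eta_X(x)\cdot\eta_A(a)=\eta_X(x\cdot a)$ for $a\in A$, $x\in X$. (Equivalently, it is obtained from $\mathcal F(A\ltimes X)=\mathcal F(A)\oplus_1\mathcal F_A(X)$ by $(\tilde a,0)(0,\tilde x)=(0,\tilde a\cdot\tilde x)$, $(0,\tilde x)(\tilde a,0)=(0,\tilde x\cdot\tilde a)$, where $A\ltimes X$ is $A\oplus_1X$ with product $(a,x)(b,y)=(ab,a\cdot y+x\cdot b)$.) *)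

(* Defs.v *)
From HB Require Import structures.
From mathcomp Require Import all_boot all_order all_algebra.
From mathcomp Require Import all_classical all_reals.
From mathcomp Require Import topology normedtype complex.

Set Implicit Arguments.
Unset Strict Implicit.
Unset Printing Implicit Defensive.
Import Order.TTheory GRing.Theory Num.Theory.
Import numFieldNormedType.Exports.
Local Open Scope classical_set_scope.
Local Open Scope ring_scope.
Local Open Scope complex_scope.


Lemma linear_continuous_bound (K : numFieldType) (V W : normedModType K)
    (f : V -> W) :
  linear f -> continuous f ->
  exists2 M : K, 0 <= M & forall x, `|f x| <= M * `|x|.
Proof.
move=> lf cf.
pose m := GRing.isLinear.Build _ _ _ _ f lf.
pose g : {linear V -> W} := HB.pack f m.
have /linear_boundedP/pinfty_ex_gt0[M M0 fM] : bounded_near g (nbhs (0 : V)).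
  exact/linear_bounded_continuous.
by exists M => //; exact: ltW.
Qed.

Lemma linear_bound_continuous (K : numFieldType) (V W : normedModType K)
    (f : V -> W) (M : K) : 0 <= M ->
  linear f -> (forall x, `|f x| <= M * `|x|) -> continuous f.
Proof.
move=> M0 lf fM.
pose m := GRing.isLinear.Build _ _ _ _ f lf.
pose g : {linear V -> W} := HB.pack f m.
apply: (@bounded_linear_continuous _ _ _ g); apply/linear_boundedP => /=.
exists M; split=> [|r Mr x]; first exact: ger0_real.
by apply: (le_trans (fM x)); apply: ler_wpM2r => //; exact: ltW.
Qed.

Section Dual.
Variables (R : realType) (V : normedModType R[i]).

Definition dual_pred : {pred V -> R[i]^o} :=
  fun f => `[< linear f /\ continuous f >].

Record dual := Dual { dual_fun :> V -> R[i]^o ; _ : dual_fun \in dual_pred }.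

HB.instance Definition _ := [isSub for dual_fun].
HB.instance Definition _ := [Choice of dual by <:].

Lemma dual_submod_closed : submod_closed dual_pred.
Proof.
split=> [|a f g /asboolP[lf cf] /asboolP[lg cg]]; apply/asboolP; split.
- by move=> k x y; rewrite /= scaler0 addr0.
- exact: cst_continuous.
- move=> k x y; rewrite !fctE lf lg !scalerDr !scalerA (mulrC a) -!addrA.
  by congr (_ + _); rewrite addrCA.
- by move=> x; exact: cvgD (cvgZl_tmp (cf x)) (cg x).
Qed.

HB.instance Definition _ := GRing.isSubmodClosed.Build _ _ dual_pred
  dual_submod_closed.
HB.instance Definition _ := [SubChoice_isSubLmodule of dual by <:].

Lemma dualE (f g : dual) : (forall x, f x = g x) -> f = g.
Proof. by move=> fg; apply/val_inj/funext. Qed.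

Lemma dual_linear (f : dual) : linear f.
Proof. by case: f => f /= /asboolP[]. Qed.

Lemma dual0 (f : dual) : f 0 = 0.
Proof.
have := dual_linear f 1 0 0.
by rewrite !scale1r addr0 -[LHS]addr0 => /addrI <-.
Qed.

Lemma dualZ (f : dual) k x : f (k *: x) = k *: f x.
Proof. by have := dual_linear f k x 0; rewrite !addr0 dual0 addr0. Qed.

Lemma dualD (f : dual) x y : f (x + y) = f x + f y.
Proof. by have := dual_linear f 1 x y; rewrite !scale1r. Qed.

Lemma dual_continuous (f : dual) : continuous f.
Proof. by case: f => f /= /asboolP[]. Qed.

Lemma dual_bound (f : dual) :
  exists2 M, 0 <= M & forall x, `|f x| <= M * `|x|.
Proof.
exact: linear_continuous_bound (@dual_linear f) (@dual_continuous f).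
Qed.

Lemma mkdual_subproof (f : V -> R[i]^o) : linear f ->
  (exists2 M, 0 <= M & forall x, `|f x| <= M * `|x|) -> f \in dual_pred.
Proof.
move=> lf [M M0 fM]; apply/asboolP; split => //.
exact: linear_bound_continuous fM.
Qed.

(* The operator norm; norms over R[i] take values in R[i], where only the real
   parts have suprema. *)
Definition dual_norm (f : dual) : R[i] :=
  (sup [set complex.Re `|f x| | x in [set x : V | `|x| <= 1]])%:C.

Lemma ReE (z : R[i]) : 0 <= z -> (complex.Re z)%:C = z.
Proof. by move=> /ger0_real/RRe_real. Qed.

Lemma dual_norm_has_sup (f : dual) :
  has_sup [set complex.Re `|f x| | x in [set x : V | `|x| <= 1]].
Proof.
split; first by exists (complex.Re `|f 0|); exists 0; rewrite //= normr0.
have [M M0 fM] := dual_bound f; exists (complex.Re M) => _ [x /= x1 <-].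
rewrite -lecR !ReE//; apply: (le_trans (fM x)).
by rewrite ler_piMr.
Qed.

Lemma dual_norm_ge0 (f : dual) : 0 <= dual_norm f.
Proof.
rewrite ler0c; apply: sup_upper_bound; first exact: dual_norm_has_sup.
exists 0; first by rewrite /= normr0.
by rewrite dual0 normr0.
Qed.

Lemma dual_normP (f : dual) x : `|f x| <= dual_norm f * `|x|.
Proof.
have [->|x0] := eqVneq x 0; first by rewrite dual0 !normr0 mulr0.
have nx : `|x| != 0 by rewrite normr_eq0.
have : `|f (`|x|^-1 *: x)| <= dual_norm f.
  rewrite -(ReE (normr_ge0 _)) lecR.
  apply: sup_upper_bound; first exact: dual_norm_has_sup.
  by exists (`|x|^-1 *: x) => //=; rewrite normrZ normfV normr_id mulVf.
rewrite dualZ normrM normfV normr_id mulrC ler_pdivrMr//.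
by rewrite lt_def nx /=.
Qed.

Lemma dual_norm_le (f : dual) M : 0 <= M ->
  (forall x, `|x| <= 1 -> `|f x| <= M) -> dual_norm f <= M.
Proof.
move=> M0 fM; rewrite -(ReE M0) lecR; apply: ge_sup.
  by have [] := dual_norm_has_sup f.
by move=> _ [x x1 <-]; rewrite -lecR !ReE//; exact: fM.
Qed.

Lemma dual_ler_normD (f g : dual) :
  dual_norm (f + g) <= dual_norm f + dual_norm g.
Proof.
apply: dual_norm_le; first by rewrite addr_ge0// dual_norm_ge0.
move=> x x1; apply: (le_trans (ler_normD _ _)); apply: lerD.
- by apply: (le_trans (dual_normP _ _)); rewrite ler_piMr// dual_norm_ge0.
- by apply: (le_trans (dual_normP _ _)); rewrite ler_piMr// dual_norm_ge0.
Qed.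

Lemma dual_normrZ_le (l : R[i]) (f : dual) :
  dual_norm (l *: f) <= `|l| * dual_norm f.
Proof.
apply: dual_norm_le; first by rewrite mulr_ge0// dual_norm_ge0.
move=> x x1; have -> : (l *: f) x = l *: f x by [].
rewrite normrZ ler_wpM2l//.
by apply: (le_trans (dual_normP _ _)); rewrite ler_piMr// dual_norm_ge0.
Qed.

Lemma dual_normrZ (l : R[i]) (f : dual) :
  dual_norm (l *: f) = `|l| * dual_norm f.
Proof.
apply/eqP; rewrite eq_le dual_normrZ_le /=.
have [->|l0] := eqVneq l 0; first by rewrite normr0 mul0r dual_norm_ge0.
rewrite -ler_pdivlMl ?normr_gt0//.
by rewrite -normfV -[f in leLHS]scale1r -(mulVf l0) -scalerA dual_normrZ_le.
Qed.

Lemma dual_normr0_eq0 (f : dual) : dual_norm f = 0 -> f = 0.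
Proof.
move=> f0; apply: dualE => x; apply/eqP; rewrite -normr_le0.
by have := dual_normP f x; rewrite f0 mul0r.
Qed.

HB.instance Definition _ := Lmodule_isNormed.Build R[i] dual
  dual_ler_normD dual_normrZ dual_normr0_eq0.

Lemma ler_dual (f : dual) x : `|f x| <= `|f| * `|x|.
Proof. exact: dual_normP. Qed.

Lemma ler_dual_norm (f : dual) M : 0 <= M ->
  (forall x, `|x| <= 1 -> `|f x| <= M) -> `|f| <= M.
Proof. exact: dual_norm_le. Qed.

End Dual.

Section WeakTopologies.
Variables (R : realType) (V : normedModType R[i]).

(* V with sigma(V, V^* ): pointwise convergence against V^* *)
Definition weak_type : Type := V.
Definition weak_emb (x : V) : {ptws dual V -> R[i]^o} := fun f => f x.
HB.instance Definition _ := Uniform.copy weak_type (initial_topology weak_emb).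
HB.instance Definition _ := GRing.Lmodule.copy weak_type V.

(* V^* with sigma(V^*, V): pointwise convergence on V *)
Definition weakstar_type : Type := dual V.
Definition weakstar_emb (f : dual V) : {ptws V -> R[i]^o} := f.
HB.instance Definition _ :=
  Uniform.copy weakstar_type (initial_topology weakstar_emb).

End WeakTopologies.

(* The image of the closed unit ball is relatively weakly compact. *)
Definition weakly_compact (R : realType) (V W : normedModType R[i])
    (T : V -> W) : Prop :=
  precompact (T @` [set x | `|x| <= 1] : set (weak_type W)).

Section WeaklyCompact.
Variables (R : realType).

Lemma weak_cvgP (V : normedModType R[i]) (F : set_system (weak_type V))
    (x : weak_type V) : Filter F ->
  F --> x <-> forall f : dual V, f y @[y --> F] --> f x.
Proof.
move=> FF; have -> : (F --> x) <-> ({ptws, weak_emb (V := V) @ F --> weak_emb x}).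
  split=> [Fx|Fx].
    apply: cvg_trans (@initial_continuous _ _ (@weak_emb R V) x).
    exact: cvg_app.
  move=> A [_ [[B oB <-] Bx] BA].
  by apply: filterS BA _; apply: Fx; exact: open_nbhs_nbhs.
exact: pointwise_cvgP.
Qed.

Lemma regular_compact_closure (T : topologicalType) (A : set T) :
  regular_space T ->
  (forall G : set_system T, ProperFilter G -> G A -> cluster G !=set0) ->
  compact (closure A).
Proof.
move=> regT cA F FF FA.
pose G : set_system T :=
  [set B | exists2 U, open U /\ F U & U `&` A `<=` B].
have PG : ProperFilter G.
  split; last split.
  - move=> [U [oU FU] UA0].
    have [x [Ux clAx]] : (U `&` closure A) !=set0.
      exact: filter_ex (filterI FU FA).
    have [y [Ay Uy]] := clAx U (open_nbhs_nbhs (conj oU Ux)).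
    exact: UA0 (conj Uy Ay).
  - by exists setT => //; split; [exact: openT|exact: filterT].
  - move=> P Q [U [oU FU] UP] [W [oW FW] WQ].
    exists (U `&` W); first by split; [exact: openI|exact: filterI].
    by move=> x [[Ux Wx] Ax]; split; [exact: UP|exact: WQ].
  - by move=> P Q PQ [U oU UP]; exists U => //; exact: subset_trans PQ.
have GA : G A by exists setT; [split; [exact: openT|exact: filterT]|move=> x []].
have [p clp] := cA G PG GA.
have clusterFp : cluster F p.
  move=> S W FS Wp.
  have [W' W'p W'W] := regT p W Wp.
  apply: contrapT => /set0P/negP/negPn/eqP SW0.
  have GW : G (~` closure W' `&` A).
    exists (~` closure W') => //; split.
      exact/closed_openC/closed_closure.
    apply: filterS FS => x Sx clx; suff : (S `&` W) x by rewrite SW0.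
    by split => //; exact: W'W.
  have [z [[W'z _] W'z']] := clp _ _ GW W'p.
  by apply: W'z; exact: subset_closure.
exists p; split => //.
have := clusterFp; rewrite clusterE => /(_ _ FA).
by rewrite -(proj1 (closure_id _) (@closed_closure _ A)).
Qed.

Lemma weakly_compactP (V W : normedModType R[i]) (T : V -> W) :
  weakly_compact T <->
  forall U : set_system V, UltraFilter U -> U [set x | `|x| <= 1] ->
    exists y : weak_type W, (T : V -> weak_type W) @ U --> y.
Proof.
rewrite /weakly_compact precompactE; split=> [cT U UU U1|cT].
  have TU : (T @ U) (closure (T @` [set x | `|x| <= 1] : set (weak_type W))).
    apply: (@filterS _ U _ _ (T @^-1` _) _ U1) => x x1.
    by apply: subset_closure; exists x.
  have [y [_ cly]] := cT _ (fmap_proper_filter _ _) TU.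
  exists y => P Py.
  have [//|UnP] := in_ultra_setVsetC (T @^-1` P) UU.
  have [z [nPz Pz]] := cly (~` P) P UnP Py.
  by case: nPz.
apply: regular_compact_closure; first exact: uniform_regular.
move=> G PG GA.
pose H : set_system V :=
  [set S | exists2 P, G P & [set x | `|x| <= 1] `&` T @^-1` P `<=` S].
have PH : ProperFilter H.
  split; last split.
  - move=> [P GP P0].
    have [y [Py [x x1 xy]]] := filter_ex (filterI GP GA).
    by apply: (P0 x); split => //; rewrite /= xy.
  - by exists setT => //; exact: filterT.
  - move=> P Q [P' GP PP] [Q' GQ QQ].
    exists (P' `&` Q'); first exact: filterI.
    by move=> x [x1 [P'x Q'x]]; split; [exact: PP|exact: QQ].
  - by move=> P Q PQ [P' GP PP]; exists P' => //; exact: subset_trans PQ.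
have [U [UU HU]] := ultraFilterLemma PH.
have U1 : U [set x | `|x| <= 1].
  by apply: HU; exists setT; [exact: filterT|move=> x []].
have [y Ty] := cT U UU U1.
exists y => P Q GP Qy.
have UP : U (T @^-1` P) by apply: HU; exists P => // x [].
have UQ : U (T @^-1` Q) by exact: Ty.
by have [x [Px Qx]] := filter_ex (filterI UP UQ); exists (T x).
Qed.

Lemma weakly_compact0 (V W : normedModType R[i]) :
  weakly_compact (fun _ : V => 0 : W).
Proof.
by apply/weakly_compactP => U UU U1; exists 0; exact: cvg_cst.
Qed.

Lemma weakly_compactZD (V W : normedModType R[i]) (k : R[i]) (S T : V -> W) :
  weakly_compact S -> weakly_compact T ->
  weakly_compact (fun x => k *: S x + T x).
Proof.
move=> /weakly_compactP cS /weakly_compactP cT; apply/weakly_compactP => U UU U1.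
have [y /weak_cvgP Sy] := cS U UU U1; have [z /weak_cvgP Tz] := cT U UU U1.
exists (k *: (y : W) + (z : W)); apply/weak_cvgP => f.
rewrite dual_linear.
suff : f (k *: S x + T x) @[x --> U] --> k *: f y + f z by [].
under eq_fun do rewrite dual_linear.
have Sf : f (S x) @[x --> U] --> f y := Sy f.
have Tf : f (T x) @[x --> U] --> f z := Tz f.
exact: cvgD (cvgZl_tmp Sf) Tf.
Qed.

End WeaklyCompact.
HB.mixin Record CompleteNormedModule_isBanachAlgebra (K : numFieldType) A
    & CompleteNormedModule K A := {
  bmul : A -> A -> A ;
  bmulA : associative bmul ;
  bmul_linearl : forall b, linear (bmul^~ b) ;
  bmul_linearr : forall a, linear (bmul a) ;
  bmul_norm : forall a b, `|bmul a b| <= `|a| * `|b| }.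

(* Submultiplicative norm, no unit required. *)
#[short(type="banachAlgType")]
HB.structure Definition BanachAlgebra (K : numFieldType) :=
  {A of CompleteNormedModule K A & CompleteNormedModule_isBanachAlgebra K A}.

HB.mixin Record NormedModule_isContractiveBimodule (K : numFieldType)
    (A : banachAlgType K) X & NormedModule K X := {
  lact : A -> X -> X ;
  ract : X -> A -> X ;
  lact_linearl : forall x, linear (lact^~ x) ;
  lact_linearr : forall a, linear (lact a) ;
  ract_linearl : forall a, linear (ract^~ a) ;
  ract_linearr : forall x, linear (ract x) ;
  lactA : forall a b x, lact a (lact b x) = lact (bmul a b) x ;
  ractA : forall x a b, ract (ract x a) b = ract x (bmul a b) ;
  lractA : forall a x b, ract (lact a x) b = lact a (ract x b) ;
  lact_norm : forall a x, `|lact a x| <= `|a| * `|x| ;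
  ract_norm : forall a x, `|ract x a| <= `|a| * `|x| }.

(* Completeness is left to banachBimodType: the duals X^* and WAP_A(X^* ), which
   are automatically complete, only need to be normed bimodules here. *)
#[short(type="contrBimodType")]
HB.structure Definition ContractiveBimodule (K : numFieldType)
    (A : banachAlgType K) :=
  {X of NormedModule K X & NormedModule_isContractiveBimodule K A X}.

#[short(type="banachBimodType")]
HB.structure Definition BanachBimodule (K : numFieldType)
    (A : banachAlgType K) :=
  {X of CompleteNormedModule K X & NormedModule_isContractiveBimodule K A X}.

(* A as a bimodule over itself *)
Definition regular (K : numFieldType) (A : banachAlgType K) : Type := A.

Section Regular.
Variables (K : numFieldType) (A : banachAlgType K).
HB.instance Definition _ := CompleteNormedModule.on (regular A).

Lemma regular_lractA (a x b : A) : bmul (bmul a x) b = bmul a (bmul x b).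
Proof. by rewrite bmulA. Qed.
Lemma regular_lactA (a b x : A) : bmul a (bmul b x) = bmul (bmul a b) x.
Proof. by rewrite bmulA. Qed.
Lemma regular_ract_norm (a x : A) : `|bmul x a| <= `|a| * `|x|.
Proof. by rewrite mulrC bmul_norm. Qed.

HB.instance Definition _ := NormedModule_isContractiveBimodule.Build K A
  (regular A) (@bmul_linearl _ A) (@bmul_linearr _ A) (@bmul_linearl _ A)
  (@bmul_linearr _ A) regular_lactA regular_lractA regular_lractA
  (@bmul_norm _ A) regular_ract_norm.
End Regular.

Section DualConstructions.
Variable R : realType.

Definition mkdual (V : normedModType R[i]) (f : V -> R[i]^o) (lf : linear f)
    (bf : exists2 M, 0 <= M & forall x, `|f x| <= M * `|x|) : dual V :=
  Dual (mkdual_subproof lf bf).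

Section Adjoint.
Variables (V W : normedModType R[i]) (T : V -> W).
Hypotheses (lT : linear T)
  (bT : exists2 M, 0 <= M & forall x, `|T x| <= M * `|x|).

Lemma adjoint_linear (phi : dual W) : linear (fun x => phi (T x)).
Proof. by move=> k x y; rewrite lT dual_linear. Qed.

Lemma adjoint_bound (phi : dual W) :
  exists2 M, 0 <= M & forall x, `|phi (T x)| <= M * `|x|.
Proof.
have [M M0 TM] := bT; exists (`|phi| * M); first exact: mulr_ge0.
move=> x; apply: (le_trans (ler_dual phi (T x))).
by rewrite -mulrA; apply: ler_wpM2l.
Qed.

Definition adjoint (phi : dual W) : dual V :=
  mkdual (adjoint_linear phi) (adjoint_bound phi).

End Adjoint.

Section BidualEmbedding.
Variable V : normedModType R[i].

Lemma bidual_emb_linear (x : V) : linear (fun f : dual V => f x : R[i]^o).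
Proof. by []. Qed.

Lemma bidual_emb_bound (x : V) :
  exists2 M, 0 <= M & forall f : dual V, `|f x| <= M * `|f|.
Proof. by exists `|x| => // f; rewrite mulrC ler_dual. Qed.

Definition bidual_emb (x : V) : dual (dual V) :=
  mkdual (bidual_emb_linear x) (bidual_emb_bound x).

End BidualEmbedding.
End DualConstructions.

Section DualBimodule.
Variables (R : realType) (A : banachAlgType R[i]) (X : contrBimodType A).
Implicit Types (a b : A) (phi : dual X) (x : X).

Lemma ract_bound a :
  exists2 M, 0 <= M & forall x : X, `|ract x a| <= M * `|x|.
Proof. by exists `|a| => // x; exact: ract_norm. Qed.

Lemma lact_bound a :
  exists2 M, 0 <= M & forall x : X, `|lact a x| <= M * `|x|.
Proof. by exists `|a| => // x; exact: lact_norm. Qed.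

(* (a . phi)(x) = phi(x . a) and (phi . a)(x) = phi(a . x) *)
Definition dual_lact a phi : dual X :=
  adjoint (@ract_linearl _ A X a) (ract_bound a) phi.
Definition dual_ract phi a : dual X :=
  adjoint (@lact_linearr _ A X a) (lact_bound a) phi.

Lemma dual_lact_linearl phi : linear (dual_lact^~ phi).
Proof. by move=> k a b; apply: dualE => x /=; rewrite ract_linearr dual_linear. Qed.
Lemma dual_lact_linearr a : linear (dual_lact a).
Proof. by move=> k f g; apply: dualE. Qed.
Lemma dual_ract_linearl a : linear (dual_ract^~ a).
Proof. by move=> k f g; apply: dualE. Qed.
Lemma dual_ract_linearr phi : linear (dual_ract phi).
Proof. by move=> k a b; apply: dualE => x /=; rewrite lact_linearl dual_linear. Qed.
Lemma dual_lactA a b phi :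
  dual_lact a (dual_lact b phi) = dual_lact (bmul a b) phi.
Proof. by apply: dualE => x /=; rewrite ractA. Qed.
Lemma dual_ractA phi a b :
  dual_ract (dual_ract phi a) b = dual_ract phi (bmul a b).
Proof. by apply: dualE => x /=; rewrite lactA. Qed.
Lemma dual_lractA a phi b :
  dual_ract (dual_lact a phi) b = dual_lact a (dual_ract phi b).
Proof. by apply: dualE => x /=; rewrite lractA. Qed.
Lemma dual_lact_norm a phi : `|dual_lact a phi| <= `|a| * `|phi|.
Proof.
apply: ler_dual_norm => [|x x1]; first exact: mulr_ge0.
apply: (le_trans (ler_dual phi (ract x a))); rewrite [leLHS]mulrC; apply: ler_wpM2r => //.
by apply: (le_trans (ract_norm _ _)); rewrite ler_piMr.
Qed.
Lemma dual_ract_norm a phi : `|dual_ract phi a| <= `|a| * `|phi|.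
Proof.
apply: ler_dual_norm => [|x x1]; first exact: mulr_ge0.
apply: (le_trans (ler_dual phi (lact a x))); rewrite [leLHS]mulrC; apply: ler_wpM2r => //.
by apply: (le_trans (lact_norm _ _)); rewrite ler_piMr.
Qed.

HB.instance Definition _ := NormedModule_isContractiveBimodule.Build R[i] A
  (dual X) dual_lact_linearl dual_lact_linearr dual_ract_linearl
  dual_ract_linearr dual_lactA dual_ractA dual_lractA dual_lact_norm
  dual_ract_norm.

End DualBimodule.

Section Wap.
Variables (R : realType) (A : banachAlgType R[i]) (E : contrBimodType A).

Definition wap_pred : {pred E} := fun x =>
  `[< weakly_compact (fun a : A => lact a x) /\
      weakly_compact (fun a : A => ract x a) >].

Record wap := Wap { wap_val :> E ; _ : wap_val \in wap_pred }.

HB.instance Definition _ := [isSub for wap_val].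
HB.instance Definition _ := [Choice of wap by <:].

Lemma lact0r (a : A) : lact a (0 : E) = 0.
Proof.
have := lact_linearr a 1 (0 : E) 0.
by rewrite !scale1r addr0 -[LHS]addr0 => /addrI <-.
Qed.

Lemma ract0l (a : A) : ract (0 : E) a = 0.
Proof.
have := ract_linearl a 1 (0 : E) 0.
by rewrite !scale1r addr0 -[LHS]addr0 => /addrI <-.
Qed.

Lemma wap_submod_closed : submod_closed wap_pred.
Proof.
split=> [|k x y /asboolP[xl xr] /asboolP[yl yr]]; apply/asboolP; split.
- by under eq_fun do rewrite lact0r; exact: weakly_compact0.
- by under eq_fun do rewrite ract0l; exact: weakly_compact0.
- by under eq_fun do rewrite lact_linearr; exact: weakly_compactZD.
- by under eq_fun do rewrite ract_linearl; exact: weakly_compactZD.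
Qed.

HB.instance Definition _ := GRing.isSubmodClosed.Build _ _ wap_pred
  wap_submod_closed.
HB.instance Definition _ := [SubChoice_isSubLmodule of wap by <:].

Lemma wap_ler_normD (x y : wap) :
  `|wap_val (x + y)| <= `|wap_val x| + `|wap_val y|.
Proof. exact: ler_normD. Qed.
Lemma wap_normrZ (k : R[i]) (x : wap) :
  `|wap_val (k *: x)| = `|k| * `|wap_val x|.
Proof. exact: normrZ. Qed.
Lemma wap_normr0_eq0 (x : wap) : `|wap_val x| = 0 -> x = 0.
Proof. by move=> /normr0_eq0 x0; apply/val_inj. Qed.

HB.instance Definition _ := Lmodule_isNormed.Build R[i] wap
  wap_ler_normD wap_normrZ wap_normr0_eq0.

Lemma wap_val_linear : linear wap_val.
Proof. by []. Qed.

Lemma wap_val_bound :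
  exists2 M, 0 <= M & forall x : wap, `|wap_val x| <= M * `|x|.
Proof. by exists 1 => // x; rewrite mul1r. Qed.

End Wap.

Section Enveloping.
Variables (R : realType) (A : banachAlgType R[i]) (X : contrBimodType A).

(* F_A(X)_* and F_A(X); F(A) is envel (regular A) *)
Definition envel_pre : normedModType R[i] := wap (dual X).
Definition envel : normedModType R[i] := dual envel_pre.

(* the adjoint of the inclusion of WAP_A(X^* ) in X^*: the quotient map
   X^** -> F_A(X) *)
Definition envel_quo : dual (dual X) -> envel :=
  adjoint (@wap_val_linear R A (dual X)) (@wap_val_bound R A (dual X)).

Definition envel_eta (x : X) : envel := envel_quo (bidual_emb x).

(* A lift along the quotient map. Every Phi has one by Hahn-Banach, so the
   default value 0 is never used. *)
Definition envel_lift (Phi : envel) : dual (dual X) :=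
  xget 0 [set Psi | envel_quo Psi = Phi].

End Enveloping.

Section Arens.
Variables (R : realType) (A : banachAlgType R[i]) (X : contrBimodType A).
Local Notation A' := (dual (regular A)).
Local Notation A'' := (dual (dual (regular A))).
Local Notation X'' := (dual (dual X)).
Implicit Types (Phi : A'') (Xi : X'') (phi : dual X).

Lemma arens_lpair_linear Xi phi : linear (fun a : regular A => Xi (ract phi a)).
Proof. by move=> k a b; rewrite ract_linearr dual_linear. Qed.

Lemma arens_lpair_bound Xi phi :
  exists2 M, 0 <= M & forall a : regular A, `|Xi (ract phi a)| <= M * `|a|.
Proof.
exists (`|Xi| * `|phi|) => [|a]; first exact: mulr_ge0.
apply: (le_trans (ler_dual Xi (ract phi a))); rewrite -mulrA.
by apply: ler_wpM2l => //; rewrite mulrC; exact: ract_norm.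
Qed.

(* Xi . phi in A^*: a |-> <Xi, phi . a> *)
Definition arens_lpair Xi phi : A' :=
  mkdual (arens_lpair_linear Xi phi) (arens_lpair_bound Xi phi).

Lemma arens_lpair_norm Xi phi : `|arens_lpair Xi phi| <= `|Xi| * `|phi|.
Proof.
apply: ler_dual_norm => [|a a1]; first exact: mulr_ge0.
apply: (le_trans (ler_dual Xi (ract phi a))).
apply: ler_wpM2l => //; apply: (le_trans (ract_norm _ _)).
by rewrite ler_piMl.
Qed.

Lemma arens_lact_linear Phi Xi : linear (fun phi => Phi (arens_lpair Xi phi)).
Proof.
move=> k f g; rewrite -dual_linear; congr (Phi _); apply: dualE => a.
by rewrite /= ract_linearl dual_linear.
Qed.

Lemma arens_lact_bound Phi Xi :
  exists2 M, 0 <= M & forall phi, `|Phi (arens_lpair Xi phi)| <= M * `|phi|.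
Proof.
exists (`|Phi| * `|Xi|) => [|phi]; first exact: mulr_ge0.
apply: (le_trans (ler_dual Phi (arens_lpair Xi phi))); rewrite -mulrA.
by apply: ler_wpM2l => //; exact: arens_lpair_norm.
Qed.

(* The actions of A^** on X^** given by the first Arens product of
   (A |x X)^**: with a -> Phi, x -> Xi weak*, these are
     Phi . Xi = lim_a lim_x a . x   and   Xi . Phi = lim_x lim_a x . a.
   For X = A, arens_lact is the first Arens product of A^**. *)
Definition arens_lact Phi Xi : X'' :=
  mkdual (arens_lact_linear Phi Xi) (arens_lact_bound Phi Xi).

Lemma arens_xpair_linear phi (x : X) : linear (fun a : regular A => phi (ract x a)).
Proof. by move=> k a b; rewrite ract_linearr dual_linear. Qed.

Lemma arens_xpair_bound phi (x : X) :
  exists2 M, 0 <= M & forall a : regular A, `|phi (ract x a)| <= M * `|a|.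
Proof.
exists (`|phi| * `|x|) => [|a]; first exact: mulr_ge0.
apply: (le_trans (ler_dual phi (ract x a))); rewrite -mulrA.
by apply: ler_wpM2l => //; rewrite mulrC; exact: ract_norm.
Qed.

(* phi . x in A^*: a |-> <phi, x . a> *)
Definition arens_xpair phi (x : X) : A' :=
  mkdual (arens_xpair_linear phi x) (arens_xpair_bound phi x).

Lemma arens_xpair_norm phi x : `|arens_xpair phi x| <= `|phi| * `|x|.
Proof.
apply: ler_dual_norm => [|a a1]; first exact: mulr_ge0.
apply: (le_trans (ler_dual phi (ract x a))).
apply: ler_wpM2l => //; apply: (le_trans (ract_norm _ _)).
by rewrite ler_piMl.
Qed.

Lemma arens_rpair_linear Phi phi :
  linear (fun x : X => Phi (arens_xpair phi x)).
Proof.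
move=> k x y; rewrite -dual_linear; congr (Phi _); apply: dualE => a.
by rewrite /= ract_linearl dual_linear.
Qed.

Lemma arens_rpair_bound Phi phi :
  exists2 M, 0 <= M & forall x : X, `|Phi (arens_xpair phi x)| <= M * `|x|.
Proof.
exists (`|Phi| * `|phi|) => [|x]; first exact: mulr_ge0.
apply: (le_trans (ler_dual Phi (arens_xpair phi x))); rewrite -mulrA.
by apply: ler_wpM2l => //; exact: arens_xpair_norm.
Qed.

(* Phi . phi in X^*: x |-> <Phi, phi . x> *)
Definition arens_rpair Phi phi : dual X :=
  mkdual (arens_rpair_linear Phi phi) (arens_rpair_bound Phi phi).

Lemma arens_rpair_norm Phi phi : `|arens_rpair Phi phi| <= `|Phi| * `|phi|.
Proof.
apply: ler_dual_norm => [|x x1]; first exact: mulr_ge0.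
apply: (le_trans (ler_dual Phi (arens_xpair phi x))).
apply: ler_wpM2l => //; apply: (le_trans (arens_xpair_norm _ _)).
by rewrite ler_piMr.
Qed.

Lemma arens_ract_linear Xi Phi : linear (fun phi => Xi (arens_rpair Phi phi)).
Proof.
move=> k f g; rewrite -dual_linear; congr (Xi _); apply: dualE => x.
transitivity (k *: Phi (arens_xpair f x) + Phi (arens_xpair g x)); last by [].
by rewrite -dual_linear; congr (Phi _); apply: dualE.
Qed.

Lemma arens_ract_bound Xi Phi :
  exists2 M, 0 <= M & forall phi, `|Xi (arens_rpair Phi phi)| <= M * `|phi|.
Proof.
exists (`|Xi| * `|Phi|) => [|phi]; first exact: mulr_ge0.
apply: (le_trans (ler_dual Xi (arens_rpair Phi phi))); rewrite -mulrA.
by apply: ler_wpM2l => //; exact: arens_rpair_norm.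
Qed.

Definition arens_ract Xi Phi : X'' :=
  mkdual (arens_ract_linear Xi Phi) (arens_ract_bound Xi Phi).

End Arens.

Section EnvelopingAction.
Variables (R : realType) (A : banachAlgType R[i]) (X : contrBimodType A).

(* The actions for which the quotient maps intertwine the Arens actions, i.e.
   those inherited from F(A |x X). Phi . Xi and Xi . Phi lie in the kernel of the
   quotient map as soon as Phi or Xi does, so the choice of lifts is immaterial. *)
Definition envel_lact (Phi : envel (regular A)) (Xi : envel X) : envel X :=
  envel_quo (arens_lact (envel_lift Phi) (envel_lift Xi)).
Definition envel_ract (Xi : envel X) (Phi : envel (regular A)) : envel X :=
  envel_quo (arens_ract (envel_lift Xi) (envel_lift Phi)).

End EnvelopingAction.

Definition envel_mul (R : realType) (A : banachAlgType R[i])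
    (Phi Psi : envel (regular A)) : envel (regular A) :=
  envel_quo (arens_lact (envel_lift Phi) (envel_lift Psi)).

(* Stated for bare operations, since F(A) and F_A(X) are not equipped here with
   banachAlgType and contrBimodType structures. *)
Definition derivation (A : Type) (X : zmodType) (mul : A -> A -> A)
    (la : A -> X -> X) (ra : X -> A -> X) (D : A -> X) : Prop :=
  forall a b, D (mul a b) = la a (D b) + ra (D a) b.

Definition weakstar_continuous (R : realType) (V W : normedModType R[i])
    (T : dual V -> dual W) : Prop :=
  continuous (T : weakstar_type V -> weakstar_type W).

(* Main.v *)
Require Import Defs.
From HB Require Import structures.
From mathcomp Require Import all_boot all_order all_algebra.
From mathcomp Require Import all_classical all_reals.
From mathcomp Require Import topology normedtype complex.
From mathcomp Require Import lra ring.

Set Implicit Arguments.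
Unset Strict Implicit.
Unset Printing Implicit Defensive.
Import Order.TTheory GRing.Theory Num.Theory.
Import numFieldNormedType.Exports.
Local Open Scope classical_set_scope.
Local Open Scope ring_scope.
Local Open Scope complex_scope.

(** Let D' : X^* -> A^* be the adjoint of D. The point is that D' maps
    WAP(X^* ) into WAP(A^* ); the extension is then the adjoint of the
    restriction of D' to these spaces, so it is weak*-weak* continuous for free.
    For phi in X^* the derivation identity reads
      a . D' phi = D' (a . phi) + S (D a),   (S x)(b) = phi (b . x),
    and similarly on the right. If phi is weakly almost periodic, the first
    summand is weakly compact in a because a |-> a . phi is. The map S is the
    transpose of b |-> phi . b, so it is weakly compact by Gantmacher's theorem
    (weakly_compact_transpose). This is where both orbit maps of phi are used
    at once: the left orbit of D' phi involves the right orbit of phi.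

    The second adjoint D'' : A^** -> X^** is a derivation for the Arens actions,
    by a computation valid for any bounded derivation (derivation_arens). It
    descends to the quotients F(A) and F_A(X) once the Arens actions do, in the
    variable Xi of X^**, because D'' Phi and any lift of its image in F_A(X)
    differ by an element of the kernel. For Phi . Xi this says that WAP(X^* ) is a
    sub-bimodule.
    For Xi . Phi it rests on arens_rpair_weak_limit: Phi . phi is a weak limit of
    points a . phi with a in A, so Xi (Phi . phi) is determined by the values of
    Xi on WAP(X^* ).

    Uniqueness holds because eta_A has weak*-dense range (envel_eta_dense).

    The functional analysis behind this is the Hahn-Banach theorem, which makes
    X^** -> F_A(X) surjective, the Banach-Alaoglu theorem, and the Goldstine
    theorem, which is deduced from Hahn-Banach through Helly's lemma. *)

(** * The Hahn-Banach theorem *)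

(** Partial linear functionals are represented by their graphs, which are
    submodules of V * K. The empty set qualifies, so that the union of an empty
    chain is admissible in Zorn's lemma. *)
Definition submodule_set (K : pzRingType) (V : lmodType K) (G : set V) : Prop :=
  forall k x y, G x -> G y -> G (k *: x + y).

Section RealHahnBanach.
Variables (R : realType) (V : lmodType R) (p : V -> R).
Hypotheses (pD : forall x y, p (x + y) <= p x + p y)
  (pZ : forall t x, 0 < t -> p (t *: x) = t * p x).
Implicit Types G : set (V * R^o).

Let dominated G := forall x, G x -> x.2 <= p x.1.

Lemma sublinear0 : p 0 = 0.
Proof. by have := pZ 0 (ltr0n R 2); rewrite scaler0; lra. Qed.

(** Domination by a sublinear functional already forces a linear relation to be
    single-valued: its values at 0 form a subspace of the line bounded above. *)
Lemma dominated_functional G x r s : submodule_set G -> dominated G ->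
  G (x, r) -> G (x, s) -> r = s.
Proof.
suff rs r' s' : submodule_set G -> dominated G -> G (x, r') -> G (x, s') ->
    r' <= s'.
  by move=> sG dG Gr Gs; apply/eqP; rewrite eq_le !rs.
move=> sG dG Gr Gs; have /dG /= := sG (-1) _ _ Gs Gr.
by rewrite !scaleN1r addNr sublinear0; lra.
Qed.

(** The value c at v has to lie between r - p (x - v) and p (y + v) - s for all
    (x, r) and (y, s) in G; subadditivity makes these bounds compatible. *)
Lemma dominated_extend G v : submodule_set G -> dominated G -> G 0 ->
  exists c, exists2 H, submodule_set H /\ dominated H & G `<=` H /\ H (v, c).
Proof.
move=> sG dG G0.
pose S := [set r | exists2 x, G x & r = x.2 - p (x.1 - v)].
have Sub x y : G x -> G y -> x.2 - p (x.1 - v) <= p (y.1 + v) - y.2.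
  move=> Gx Gy; have /dG := sG 1 _ _ Gx Gy; rewrite scale1r /=.
  have := pD (x.1 - v) (y.1 + v); rewrite addrACA addNr addr0; lra.
have S0 : S !=set0 by eexists; exists 0.
have supS : has_sup S.
  split=> //; exists (p ((0 : V * R^o).1 + v) - (0 : V * R^o).2).
  by move=> _ [x Gx ->]; exact: Sub.
pose c := sup S.
have cl x : G x -> x.2 - c <= p (x.1 - v).
  move=> Gx; have : S (x.2 - p (x.1 - v)) by exists x.
  by move=> /(sup_upper_bound supS); rewrite -/c; lra.
have cr x : G x -> x.2 + c <= p (x.1 + v).
  move=> Gx; suff : c <= p (x.1 + v) - x.2 by lra.
  by apply: ge_sup => // _ [y Gy ->]; exact: Sub.
have GZ t x : G x -> G (t *: x).
  by move=> Gx; have := sG t _ _ Gx G0; rewrite addr0.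
exists c, [set z | exists2 x, G x & exists t, z = (x.1 + t *: v, x.2 + t * c)].
  split=> [k _ _ [x Gx [t ->]] [y Gy [s ->]]|_ [x Gx [t ->]] /=].
    exists (k *: x + y); first exact: sG.
    exists (k * t + s); congr (_, _) => /=.
      by rewrite scalerDr scalerA addrACA scalerDl.
    by rewrite mulrDl -mulrA /GRing.scale/=; ring.
  (* rescaling by |t| reduces to t = 1 and t = -1 *)
  have [t0|t0|->] := ltgtP t 0; last by rewrite scale0r mul0r !addr0 dG.
  - have t'0 : 0 < - t by rewrite oppr_gt0.
    have := cl _ (GZ (- t)^-1 _ Gx).
    rewrite -(ler_pM2l t'0) -pZ// scalerBr/= scalerA divff ?gt_eqF// scale1r.
    rewrite scaleNr opprK mulrBr /GRing.scale/= mulrA divff ?gt_eqF// mul1r.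
    by rewrite mulNr opprK.
  - have := cr _ (GZ t^-1 _ Gx).
    rewrite -(ler_pM2l t0) -pZ// scalerDr/= scalerA divff ?gt_eqF// scale1r.
    by rewrite mulrDr /GRing.scale/= mulrA divff ?gt_eqF// mul1r.
split=> [x Gx|].
  by exists x => //; exists 0; rewrite scale0r mul0r !addr0; case: x Gx.
by exists 0 => //; exists 1; rewrite scale1r mul1r !add0r.
Qed.

Theorem real_hahn_banach G : submodule_set G -> dominated G -> G 0 ->
  exists2 u : V -> R, (forall t x y, u (t *: x + y) = t * u x + u y) /\
    (forall x, u x <= p x) & forall x, G x -> u x.1 = x.2.
Proof.
move=> sG dG G0.
(* containing G is required of nonempty A only, to let the empty chain through *)
pose P := [set A | [/\ submodule_set A, dominated A & A !=set0 -> G `<=` A]].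
have [|A [[sA dA GA] Amax]] := @Zorn_bigcup _ P.
  move=> F FP totF; split.
  - move=> k x y [X FX Xx] [Y FY Yy].
    have [XY|YX] := totF _ _ FX FY.
      by exists Y => //; have [sY _ _] := FP _ FY; apply: sY => //; exact: XY.
    by exists X => //; have [sX _ _] := FP _ FX; apply: sX => //; exact: YX.
  - by move=> x [X FX Xx]; have [_ dX _] := FP _ FX; exact: dX.
  - move=> [x [X FX Xx]] y Gy; exists X => //.
    by have [_ _ GX] := FP _ FX; apply: GX => //; exists x.
have maxA B :
    submodule_set B -> dominated B -> G `<=` B -> A `<=` B -> B `<=` A.
  by move=> sB dB GB AB; apply: contrapT => nBA; apply: (Amax B).
have {}GA : G `<=` A.
  apply: GA; apply/set0P/eqP => A0; have := maxA _ sG dG (@subset_refl _ _).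
  by rewrite A0 => /(_ (sub0set _) _ G0).
have totA v : exists c, A (v, c).
  have [c [H [sH dH] [AH Hv]]] := dominated_extend v sA dA (GA _ G0).
  by exists c; apply: (maxA H) => //; exact: subset_trans AH.
have [u Au] := choice totA; exists u; [split=> [t x y|x]|] => [||x Gx].
- apply: (dominated_functional sA dA (Au _)).
  exact: (sA _ _ _ (Au x) (Au y)).
- exact: (dA _ (Au x)).
- apply: (dominated_functional sA dA (Au _)).
  by apply: GA; case: x Gx.
Qed.

End RealHahnBanach.

(** The alias carries the real structure, V itself keeps the complex one. *)
Definition realified (R : rcfType) (V : lmodType R[i]) : Type := V.

Section Realified.
Variables (R : rcfType) (V : lmodType R[i]).
HB.instance Definition _ := GRing.Zmodule.on (realified V).

Let scale (t : R) (x : realified V) : realified V := t%:C *: (x : V).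

Let scaleA a b v : scale a (scale b v) = scale (a * b) v.
Proof. by rewrite /scale scalerA rmorphM. Qed.
Let scale1 : left_id 1 scale.
Proof. by move=> v; rewrite /scale scale1r. Qed.
Let scaleDr : right_distributive scale +%R.
Proof. by move=> a x y; rewrite /scale scalerDr. Qed.
Let scaleDl v : {morph scale^~ v : a b / a + b}.
Proof. by move=> a b; rewrite /scale rmorphD scalerDl. Qed.

HB.instance Definition _ := GRing.Zmodule_isLmodule.Build R (realified V)
  scaleA scale1 scaleDr scaleDl.
End Realified.

(** A complex functional f is recovered from its real part u by
    f x = u x - i u (i x), so the real theorem applies to real parts. The bound
    carries over because f x can be made real and nonnegative by rotating x. *)
Theorem hahn_banach (R : realType) (V : lmodType R[i]) (p : V -> R)
    (pD : forall x y, p (x + y) <= p x + p y)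
    (pZ : forall k x, p (k *: x) = complex.Re `|k| * p x)
    (G : set (V * R[i]^o)) :
  submodule_set G -> (forall x, G x -> `|x.2| <= (p x.1)%:C) -> G 0 ->
  exists2 f : V -> R[i]^o, linear f /\ (forall x, `|f x| <= (p x)%:C) &
    forall x, G x -> f x.1 = x.2.
Proof.
move=> sG dG G0.
pose Gr : set (realified V * R^o) :=
  [set y | exists2 x, G x & y = (x.1, complex.Re x.2)].
have [|k _ _ [x Gx ->] [y Gy ->]|_ [x Gx ->]||u [ul up] uG] :=
  @real_hahn_banach R (realified V) p pD _ Gr.
- by move=> t x t0; rewrite [_ *: _]/(t%:C *: (x : V)) pZ ger0_norm ?ler0c ?ltW.
- exists (k%:C *: x + y); first exact: sG.
  congr (_, _); rewrite [RHS]/(complex.Re (k%:C * x.2 + y.2)) /=.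
  by case: (x.2) (y.2) => a b [c d] /=; rewrite mul0r subr0.
- rewrite /= -lecR; apply: le_trans (dG _ Gx).
  apply: le_trans (normc_ge_Re _); rewrite lecR; exact: ler_norm.
- by exists 0.
have uZ (k : R[i]) (x y : V) : u (k *: x + y) =
    complex.Re k * u x + complex.Im k * u ('i%C *: x) + u y.
  rewrite -addrA -!ul; congr u; rewrite addrA; congr (_ + _).
  rewrite [in LHS](complexE k) scalerDl mulrC -scalerA.
  by [].
pose f (x : V) : R[i]^o := (u x +i* - u ('i%C *: x)).
have fl : linear f.
  move=> k x y.
  have ik : 'i%C *: (k *: x + y) = k *: ('i%C *: x) + 'i%C *: y.
    by rewrite scalerDr !scalerA mulrC.
  have ii : 'i%C *: ('i%C *: x) = - x by rewrite scalerA -expr2 sqr_i scaleN1r.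
  rewrite /f ik !uZ ii.
  have u0 : u 0 = 0 by have := ul (-1) 0 0; rewrite scaler0 addr0; lra.
  have -> : u (- x) = - u x.
    by have := uZ (-1) x 0; rewrite scaleN1r addr0 u0 /=; lra.
  case: k {ik} => a b.
  transitivity ((a +i* b) * f x + f y : R[i]); last by [].
  by rewrite /f /=; congr (_ +i* _) => /=; ring.
exists f; last first.
  move=> x Gx; rewrite /f; have Gix := sG 'i%C _ _ Gx G0.
  rewrite (uG (x.1, complex.Re x.2)); last by exists x.
  have /= -> := uG (('i%C *: x).1, complex.Re ('i%C *: x).2).
    by case: (x.2) => a b /=; congr (_ +i* _); ring.
  by exists ('i%C *: x); rewrite // -[_ *: x]addr0.
split=> // x; have [fx0|fx0] := eqVneq (f x) 0.
  have p0 : p 0 = 0 by rewrite -(scale0r (0 : V)) pZ normr0 mul0r.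
  have := pD x (- x); rewrite fx0 normr0 ler0c subrr p0 -scaleN1r pZ normrN1.
  by rewrite mul1r; lra.
pose k := `|f x| / f x.
have k1 : `|k| = 1 by rewrite normrM normr_id normfV divff// normr_eq0.
have fk : f (k *: x) = `|f x|.
  have f0 : f 0 = 0.
    by have := fl (-1) (0 : V) 0; rewrite !scaleN1r !addNr.
  have := fl k x 0; rewrite f0 !addr0 => ->.
  by rewrite -[RHS](mulfVK fx0).
have := up (k *: x); rewrite pZ k1 mul1r -lecR; apply: le_trans.
by have -> : u (k *: x) = complex.Re (f (k *: x)) by []; rewrite fk Defs.ReE.
Qed.

(** * Bounded extension, Helly's lemma and Goldstine's theorem *)

Lemma dualB (R : realType) (V : normedModType R[i]) (f : dual V) x y :
  f (x - y) = f x - f y.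
Proof. by rewrite dualD -scaleN1r dualZ scaleN1r. Qed.

Section BoundedExtension.
Variables (R : realType) (V : normedModType R[i]).

Lemma bounded_extension (M : R[i]) (G : set (V * R[i]^o)) :
  0 <= M -> submodule_set G -> (forall x, G x -> `|x.2| <= M * `|x.1|) -> G 0 ->
  exists2 f : dual V, `|f| <= M & forall x, G x -> f x.1 = x.2.
Proof.
move=> M0 sG MG G0.
pose p (x : V) := complex.Re (M * `|x|).
have pE x : (p x)%:C = M * `|x| by rewrite Defs.ReE// mulr_ge0.
have [x y|k x||f [fl fp] fG] := @hahn_banach R V p _ _ G sG _ G0.
- by rewrite -lecR rmorphD /= !pE -mulrDr ler_wpM2l// ler_normD.
- apply: complexI; rewrite [RHS]rmorphM pE [RHS]/= pE normrZ.
  by rewrite -[(Normc.normc k)%:C]/`|k|; ring.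
- by move=> x /MG; rewrite pE.
have fM x : `|f x| <= M * `|x| by rewrite -pE.
exists (mkdual fl (ex_intro2 _ _ M M0 fM)) => //.
apply: ler_dual_norm => // x x1; apply: (le_trans (fM x)).
by rewrite ler_piMr.
Qed.

End BoundedExtension.

Section Helly.
Variables (R : realType) (V : normedModType R[i]).
Implicit Types (s : seq (dual V)) (f : dual (dual V)) (phi psi : dual V).

Let kernel s : set V := [set x | forall psi, psi \in s -> psi x = 0].

Lemma kernel_cons psi s : (forall x, kernel s x -> psi x = 0) \/
  exists2 e, kernel s e & psi e = 1.
Proof.
have [s0|/existsNP[x /not_implyP[sx /eqP px]]] :=
  pselect (forall x, kernel s x -> psi x = 0); [by left|right].
exists ((psi x)^-1 *: x) => [chi chis|]; last first.
  by rewrite dualZ; exact: mulVf.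
by rewrite dualZ (sx _ chis) scaler0.
Qed.

(** A functional that vanishes where all those of s do is a linear combination
    of s. Evaluations at x0 and f agree on s, hence on such a functional. *)
Lemma annihilator_kernel f s x0 phi :
  (forall psi, psi \in s -> psi x0 = f psi) ->
  (forall x, kernel s x -> phi x = 0) -> phi x0 = f phi.
Proof.
elim: s phi => [|psi s IHs] phi x0s phi0.
  have -> : phi = 0 by apply: dualE => x; rewrite phi0.
  by rewrite dual0.
have {}IHs (chi : dual V) :
    (forall x : V, kernel s x -> chi x = 0) -> chi x0 = f chi.
  by apply: IHs => // rho rhos; apply: x0s; rewrite inE rhos orbT.
have [psi0|[e es psie]] := kernel_cons psi s.
  apply: IHs => x sx; apply: phi0 => chi; rewrite inE.
  move=> /predU1P[->|]; last exact: sx.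
  exact: psi0.
have : (phi - phi e *: psi) x0 = f (phi - phi e *: psi).
  apply: IHs => x sx; transitivity (phi (x - psi x *: e)).
    by rewrite dualB dualZ [psi x *: _]mulrC.
  apply: phi0 => chi; rewrite inE => /predU1P[->|chis].
    by rewrite dualB dualZ psie [_ *: _]mulr1 subrr.
  by rewrite dualB dualZ (sx _ chis) (es _ chis) scaler0 subr0.
rewrite dualB dualZ -(x0s psi) ?mem_head// => /addIr.
exact.
Qed.

Lemma interpolation f s : exists x0, forall psi, psi \in s -> psi x0 = f psi.
Proof.
elim: s => [|psi s [x0 x0s]]; first by exists 0.
have [psi0|[e es psie]] := kernel_cons psi s.
  exists x0 => chi; rewrite inE => /predU1P[->|]; last exact: x0s.
  exact: (annihilator_kernel x0s).
exists (x0 + (f psi - psi x0) *: e) => chi; rewrite inE dualD dualZ.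
move=> /predU1P[->|chis]; last by rewrite (es _ chis) scaler0 addr0 x0s.
by rewrite psie [_ *: _]mulr1 addrC subrK.
Qed.

(** If no solution had norm at most M, then the functional t x0 + n |-> t, with
    x0 any solution and n in the common kernel of s, would have norm at most 1/M.
    Its extension phi is a combination of s with f phi = phi x0 = 1, which
    contradicts |f| < M. *)
Lemma helly f s (M : R[i]) : `|f| < M ->
  exists2 x, `|x| <= M & forall psi, psi \in s -> psi x = f psi.
Proof.
move=> fM; have M0 : 0 < M := le_lt_trans (normr_ge0 f) fM.
apply: contrapT => nx.
have [x0 x0s] := interpolation f s.
have large n : kernel s n -> M < `|x0 + n|.
  move=> sn; rewrite real_ltNge ?normr_real ?gtr0_real//; apply/negP => xnM.
  apply: nx.
  by exists (x0 + n) => // psi psis; rewrite dualD sn// addr0 x0s.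
pose G : set (V * R[i]^o) :=
  [set z | exists2 n, kernel s n & exists t, z = (t *: x0 + n, t)].
have [||_ [n sn [t ->]] /=||phi phiM phiG] := @bounded_extension R V M^-1 G.
- by rewrite invr_ge0 ltW.
- move=> k _ _ [n sn [t ->]] [m sm [u ->]].
  exists (k *: n + m) => [psi psis|].
    by rewrite dualD dualZ (sn _ psis) (sm _ psis) scaler0 addr0.
  exists (k * t + u); congr (_, _) => /=.
  by rewrite scalerDr addrACA scalerA scalerDl.
- rewrite mulrC ler_pdivlMr//.
  have [->|t0] := eqVneq t 0; first by rewrite normr0 mul0r.
  have -> : t *: x0 + n = t *: (x0 + t^-1 *: n).
    by rewrite scalerDr scalerA divff// scale1r.
  rewrite normrZ ler_wpM2l// ltW// large// => psi psis.
  by rewrite dualZ (sn _ psis) scaler0.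
- by exists 0 => [psi _|]; [rewrite dual0 | exists 0; rewrite scale0r addr0].
have phi1 : f phi = 1.
  rewrite -(annihilator_kernel x0s) => [|n sn].
    apply: (phiG (x0, 1)); exists 0 => [psi _|]; first by rewrite dual0.
    by exists 1; rewrite scale1r addr0.
  by apply: (phiG (n, 0)); exists n => //; exists 0; rewrite scale0r add0r.
have := ler_dual f phi; rewrite phi1 normr1; apply/negP.
rewrite -real_ltNge ?real1 ?realM ?normr_real//.
apply: (@le_lt_trans _ _ (`|f| / M)); first by rewrite ler_wpM2l.
by rewrite ltr_pdivrMr// mul1r.
Qed.

End Helly.

(** Helly's lemma even gives points of the ball at which prescribed finitely many
    functionals take exactly the values prescribed by f; the sets of these points
    generate a filter. Helly's lemma requires a radius larger than |f|. *)
Theorem goldstine (R : realType) (V : normedModType R[i]) (f : dual (dual V)) :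
  exists2 F : set_system V, UltraFilter F &
    F [set x | `|x| <= `|f| + 1] /\
    forall phi : dual V, phi x @[x --> F] --> f phi.
Proof.
pose E (s : seq (dual V)) : set V :=
  [set x | `|x| <= `|f| + 1 /\ forall psi, psi \in s -> psi x = f psi].
pose G : set_system V := [set P | exists s, E s `<=` P].
have PG : ProperFilter G.
  split; last split.
  - move=> [s Es]; have [|x x1 xs] := @helly R V f s (`|f| + 1).
      by rewrite ltrDl.
    exact: (Es x).
  - by exists [::].
  - move=> P Q [s sP] [t tQ]; exists (s ++ t) => x [x1 xst].
    split; [apply: sP|apply: tQ]; split=> // psi psis; apply: xst.
      by rewrite mem_cat psis.
    by rewrite mem_cat psis orbT.
  - by move=> P Q PQ [s sP]; exists s; exact: subset_trans PQ.
have [F [UF GF]] := ultraFilterLemma PG.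
exists F => //; split=> [|phi]; first by apply: GF; exists [::] => x [].
apply: cvg_near_cst; apply: GF; exists [:: phi] => x [_ xphi] /=.
by apply: xphi; rewrite mem_head.
Qed.

(** * Weak compactness and Gantmacher's theorem *)

Lemma ultra_image T T' (g : T -> T') (F : set_system T) :
  UltraFilter F -> UltraFilter (g @ F).
Proof.
move=> UF; split=> [|G PG FG]; first exact: fmap_proper_filter.
apply/seteqP; split=> // A GA.
have [//|FnA] := in_ultra_setVsetC (g @^-1` A) UF.
have : G (~` A) by exact: FG.
by move=> /(filterI GA)/filter_ex[x []].
Qed.

(** Heine-Borel for the real and imaginary parts. *)
Lemma complex_ultra_cvg (R : realType) (F : set_system R[i]^o) (M : R[i]) :
  UltraFilter F -> F [set z | `|z| <= M] -> exists l : R[i]^o, F --> l.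
Proof.
move=> UF FM; pose r := complex.Re M.
have part (g : R[i] -> R) : (forall z, (`|g z|)%:C <= `|z|) ->
    exists a : R, g z @[z --> F] --> a.
  move=> gz; have := @segment_compact R (- r) r; rewrite compact_ultra.
  move=> /(_ (g @ F) (ultra_image _ UF))[|a [_ ga]]; last by exists a.
  apply: (@filterS _ F _ [set z | `|z| <= M]) => // z /= zM.
  rewrite in_itv /= -ler_norml -lecR Defs.ReE ?(le_trans (gz z))//.
  exact: le_trans zM.
have [a Fa] := part (fun z => complex.Re z) (@normc_ge_Re _).
have [|b Fb] := part (fun z => complex.Im z).
  move=> z; rewrite -normrN -ReiNIm (le_trans (normc_ge_Re _))// normrM.
  by rewrite [`|'i%C|]normc_def /= expr0n expr1n add0r sqrtr1 mulr1.
have toC (g : R[i] -> R) (c : R) : g z @[z --> F] --> c ->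
    ((g z)%:C : R[i]^o) @[z --> F] --> (c%:C : R[i]^o).
  move=> /cvgrPdist_lt gc; apply/cvgrPdist_lt => e e0.
  have re0 : 0 < complex.Re e by rewrite -ltcR Defs.ReE// ltW.
  apply: filterS (gc _ re0) => z; rewrite -ltcR Defs.ReE ?ltW//.
  by rewrite -rmorphB normc_def /= expr0n addr0 sqrtr_sqr.
exists (a%:C + 'i%C * b%:C).
have : ((complex.Re z)%:C + 'i%C * (complex.Im z)%:C : R[i]^o) @[z --> F] -->
    (a%:C + 'i%C * b%:C : R[i]^o).
  by apply: cvgD; [exact: toC|apply: cvgZl_tmp; exact: toC].
by under eq_fun do rewrite -complexE.
Qed.

Section Weak.
Variable R : realType.
Implicit Types V W E : normedModType R[i].

Lemma scalar_cvg_unique T (F : set_system T) {FF : ProperFilter F}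
    (g : T -> R[i]^o) (a b : R[i]^o) :
  g x @[x --> F] --> a -> g x @[x --> F] --> b -> a = b.
Proof. by apply: cvg_unique; exact: norm_hausdorff. Qed.

(** The Banach-Alaoglu theorem for bounded ultrafilters on V, seen inside V^**. *)
Theorem alaoglu V (M : R[i]) (F : set_system V) : 0 <= M ->
  UltraFilter F -> F [set x | `|x| <= M] ->
  exists f : dual (dual V), forall phi : dual V, phi x @[x --> F] --> f phi.
Proof.
move=> M0 UF FM.
have lim (phi : dual V) : exists l : R[i]^o, phi x @[x --> F] --> l.
  apply: (@complex_ultra_cvg R (phi @ F) (`|phi| * M) (ultra_image _ UF)).
  apply: (@filterS _ F _ [set x | `|x| <= M]) => // x /= xM.
  by apply: (le_trans (ler_dual phi x)); exact: ler_wpM2l.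
have [f Ff] := choice lim.
have fl : linear f.
  move=> k phi psi; apply: (scalar_cvg_unique (Ff _)).
  exact: cvgD (cvgZl_tmp (Ff phi)) (Ff psi).
have fM phi : `|f phi| <= M * `|phi|.
  apply/ler_addgt0Pr => e e0; have /cvgrPdist_le/(_ e e0) Fe := Ff phi.
  have [x [xe xM]] := filter_ex (filterI Fe FM).
  rewrite -[f phi](subrK (phi x)) (le_trans (ler_normD _ _))// addrC lerD//.
  by rewrite (le_trans (ler_dual phi x))// mulrC ler_wpM2r.
by exists (mkdual fl (ex_intro2 _ _ M M0 fM)).
Qed.

Lemma weakstar_cvgP V (F : set_system (weakstar_type V)) (f : weakstar_type V) :
  Filter F ->
  F --> f <-> forall x : V, (g : dual V) x @[g --> F] --> (f : dual V) x.
Proof.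
move=> FF.
have -> : (F --> f) <->
    ({ptws, weakstar_emb (V := V) @ F --> weakstar_emb f}).
  split=> [Ff|Ff].
    apply: cvg_trans (@initial_continuous _ _ (@weakstar_emb R V) f).
    exact: cvg_app.
  move=> A [_ [[B oB <-] Bf] BA].
  by apply: filterS BA _; apply: Ff; exact: open_nbhs_nbhs.
exact: pointwise_cvgP.
Qed.

(** Weak compactness only speaks of the unit ball; linearity gives all balls. *)
Lemma weakly_compact_bounded_ultra V W (T : V -> W) (M : R[i])
    (F : set_system V) :
  linear T -> 0 < M -> weakly_compact T -> UltraFilter F ->
  F [set x | `|x| <= M] ->
  exists y, forall f : dual W, f (T x) @[x --> F] --> f y.
Proof.
move=> lT M0 /weakly_compactP cT UF FM.
have M'0 : M != 0 by rewrite gt_eqF.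
have [|y /weak_cvgP Ty] := cT (( *:%R M^-1) @ F) (ultra_image _ UF).
  apply: (@filterS _ F _ [set x | `|x| <= M]) => // x /= xM.
  by rewrite normrZ normfV gtr0_norm// mulrC ler_pdivrMr ?mul1r.
exists (M *: (y : W)) => f; rewrite dualZ.
have TZ k x : T (k *: x) = k *: T x.
  have T0 : T 0 = 0 by have := lT (-1) 0 0; rewrite !scaleN1r !addNr.
  by have := lT k x 0; rewrite T0 !addr0.
have Tyf : f (T (M^-1 *: x)) @[x --> F] --> f y := Ty f.
rewrite (_ : (fun x => f (T x)) = fun x => M *: f (T (M^-1 *: x))).
  exact: cvgZl_tmp.
by apply/funext => x; rewrite TZ dualZ scalerA divff// scale1r.
Qed.

Lemma weakly_compact_comp V W E (T : V -> W) (L : W -> E) :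
  linear L -> continuous L -> weakly_compact T -> weakly_compact (L \o T).
Proof.
move=> lL cL /weakly_compactP cT; apply/weakly_compactP => F UF F1.
have [y /weak_cvgP Ty] := cT F UF F1.
exists (L y); apply/weak_cvgP => f.
exact: (Ty (adjoint lL (linear_continuous_bound lL cL) f)).
Qed.

Lemma weakly_compact_precomp V W E (L : E -> V) (T : V -> W) :
  linear L -> continuous L -> linear T -> weakly_compact T ->
  weakly_compact (T \o L).
Proof.
move=> lL cL lT cT; apply/weakly_compactP => F UF F1.
have [M M0 LM] := linear_continuous_bound lL cL.
have [||y Ty] := @weakly_compact_bounded_ultra _ _ T (M + 1) (L @ F) lT _ cT
  (ultra_image _ UF).
- by rewrite ltr_pwDr.
- apply: (@filterS _ F _ [set x | `|x| <= 1]) => // x /= x1.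
  apply: (le_trans (LM x)).
  apply: (@le_trans _ _ M); first by rewrite ler_piMr.
  by rewrite lerDl.
by exists y; apply/weak_cvgP.
Qed.

(** Gantmacher's theorem. Given an ultrafilter U on the ball of W with weak* limit
    Xi in W^**, the weak limit of S along U is v |-> Xi (T v). Indeed let f in
    V^** be the weak* limit of a bounded ultrafilter F on V. Since T is weakly
    compact, T converges weakly along F to some psi in W^*, so that
    f (S w) = psi w, which tends to Xi psi = f y. *)
Theorem weakly_compact_transpose V W (T : V -> dual W) (S : W -> dual V) :
  linear T -> continuous T -> (forall v w, S w v = T v w) ->
  weakly_compact T -> weakly_compact S.
Proof.
move=> lT cT ST wT; apply/weakly_compactP => U UU U1.
have [Xi UXi] := alaoglu ler01 UU U1.
pose y : dual V := adjoint lT (linear_continuous_bound lT cT) Xi.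
exists y; apply/weak_cvgP => f.
have [F UF [Ff FV]] := goldstine f.
have [|psi Fpsi] := weakly_compact_bounded_ultra lT _ wT UF Ff.
  by rewrite ltr_wpDl.
have fS w : f (S w) = psi w.
  apply: (scalar_cvg_unique (FV (S w))).
  under eq_fun do rewrite ST.
  exact: (Fpsi (bidual_emb w)).
have -> : f y = Xi psi by exact: (scalar_cvg_unique (FV y)) (Fpsi Xi).
have Sf : f \o S = psi by apply/funext => w; exact: fS.
suff : (f \o S) w @[w --> U] --> Xi psi by [].
by rewrite Sf; exact: UXi.
Qed.

End Weak.

(** * Adjoints *)

Lemma weakstar_continuousP (R : realType) (V W : normedModType R[i])
    (T : dual V -> dual W) : weakstar_continuous T <->
  forall (F : set_system (dual V)) (f : dual V), Filter F ->
    (forall x, g x @[g --> F] --> f x) -> forall y, T g y @[g --> F] --> T f y.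
Proof.
split=> [cT F f FF Ff|cT f].
  have Ff' : (F : set_system (weakstar_type V)) --> (f : weakstar_type V).
    exact/weakstar_cvgP.
  apply/(@weakstar_cvgP _ _ (T @ F) (T f)).
  by move=> B /cT /Ff'.
have FF : Filter (nbhs (f : weakstar_type V)) by exact: nbhs_filter.
apply/(@weakstar_cvgP _ _ (T @ nbhs (f : weakstar_type V)) (T f)).
apply: (cT (nbhs (f : weakstar_type V))).
exact/(@weakstar_cvgP _ _ (nbhs (f : weakstar_type V)) f).
Qed.

Section Adjoint.
Variables (R : realType) (V W : normedModType R[i]) (T : V -> W).
Hypotheses (lT : linear T)
  (bT : exists2 M, 0 <= M & forall x, `|T x| <= M * `|x|).

Lemma adjoint_map_linear : linear (adjoint lT bT).
Proof. by move=> k f g; apply: dualE. Qed.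

Lemma adjoint_map_continuous : continuous (adjoint lT bT).
Proof.
have [M M0 TM] := bT.
apply: (linear_bound_continuous M0 adjoint_map_linear) => f.
apply: ler_dual_norm => [|x x1]; first exact: mulr_ge0.
apply: (le_trans (ler_dual f (T x))); rewrite mulrC; apply: ler_wpM2r => //.
by apply: (le_trans (TM x)); rewrite ler_piMr.
Qed.

Lemma adjoint_weakstar_continuous : weakstar_continuous (adjoint lT bT).
Proof.
by apply/weakstar_continuousP => F f FF Ff x; exact: (Ff (T x)).
Qed.

End Adjoint.

(** * WAP(E) is a sub-bimodule *)

Section WapBimodule.
Variables (R : realType) (A : banachAlgType R[i]) (E : contrBimodType A).

Lemma bmulr_continuous (a : A) : continuous (bmul^~ a).
Proof.
apply: (linear_bound_continuous (normr_ge0 a) (@bmul_linearl _ A a)) => b.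
by rewrite mulrC bmul_norm.
Qed.

Lemma bmull_continuous (a : A) : continuous (bmul a).
Proof.
apply: (linear_bound_continuous (normr_ge0 a) (@bmul_linearr _ A a)) => b.
exact: bmul_norm.
Qed.

Lemma lact_continuousr (a : A) : continuous (lact a : E -> E).
Proof.
apply: (linear_bound_continuous (normr_ge0 a) (@lact_linearr _ A E a)) => b.
exact: lact_norm.
Qed.

Lemma ract_continuousl (a : A) : continuous ((ract (s := E))^~ a).
Proof.
apply: (linear_bound_continuous (normr_ge0 a) (@ract_linearl _ A E a)) => b.
exact: ract_norm.
Qed.

Lemma lact_continuousl (x : E) : continuous (lact^~ x).
Proof.
apply: (linear_bound_continuous (normr_ge0 x) (@lact_linearl _ A E x)) => b.
by rewrite mulrC lact_norm.
Qed.

Lemma ract_continuousr (x : E) : continuous (ract x).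
Proof.
apply: (linear_bound_continuous (normr_ge0 x) (@ract_linearr _ A E x)) => b.
by rewrite mulrC ract_norm.
Qed.

Lemma wap_lact (a : A) (x : E) :
  x \in @wap_pred R A E -> lact a x \in @wap_pred R A E.
Proof.
move=> /asboolP[xl xr]; apply/asboolP; split.
  under eq_fun do rewrite lactA.
  exact: (weakly_compact_precomp (@bmul_linearl _ A a) (@bmulr_continuous a)
    (@lact_linearl _ A E x) xl).
under eq_fun do rewrite lractA.
exact: (weakly_compact_comp (@lact_linearr _ A E a) (@lact_continuousr a) xr).
Qed.

Lemma wap_ract (a : A) (x : E) :
  x \in @wap_pred R A E -> ract x a \in @wap_pred R A E.
Proof.
move=> /asboolP[xl xr]; apply/asboolP; split.
  under eq_fun do rewrite -lractA.
  exact: (weakly_compact_comp (@ract_linearl _ A E a) (@ract_continuousl a) xl).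
under eq_fun do rewrite ractA.
exact: (weakly_compact_precomp (@bmul_linearr _ A a) (@bmull_continuous a)
  (@ract_linearr _ A E x) xr).
Qed.

End WapBimodule.

(** * The quotient map from the bidual onto the enveloping dual *)

Section EnvelLift.
Variables (R : realType) (A : banachAlgType R[i]) (X : contrBimodType A).
Implicit Types (Phi : envel X) (Xi : dual (dual X)).

Lemma envel_quo_eqP Xi Xi' : envel_quo Xi = envel_quo Xi' ->
  forall phi, phi \in @wap_pred R A (dual X) -> Xi phi = Xi' phi.
Proof.
by move=> qE phi wphi; exact: (congr1 (fun f : envel X => f (Wap wphi)) qE).
Qed.

(** Hahn-Banach extension of Phi from WAP(X^* ) to X^*. *)
Lemma envel_liftK Phi : envel_quo (envel_lift Phi) = Phi.
Proof.
rewrite /envel_lift; case: xgetP => [Xi -> //|nXi].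
pose G : set (dual X * R[i]^o) :=
  [set z | exists w : wap (dual X), z = (wap_val w, Phi w)].
have [k _ _ [w ->] [v ->]|_ [w ->]||Xi _ XiG] :=
  @bounded_extension R (dual X) `|Phi| G (normr_ge0 _).
- by exists (k *: w + v); rewrite dual_linear.
- exact: ler_dual.
- by exists 0; rewrite dual0.
exfalso; apply: (nXi Xi); apply: dualE => w.
by apply: (XiG (wap_val w, Phi w)); exists w.
Qed.

Lemma envel_eta_dense Phi : exists2 F : set_system X, UltraFilter F &
  forall w : wap (dual X), envel_eta x w @[x --> F] --> Phi w.
Proof.
have [F UF [_ FPhi]] := goldstine (envel_lift Phi).
exists F => // w; rewrite -[in X in _ --> X](envel_liftK Phi).
exact: FPhi.
Qed.

Lemma arens_lact_quo (Psi : dual (dual (regular A))) Xi Xi' :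
  envel_quo Xi = envel_quo Xi' ->
  envel_quo (arens_lact Psi Xi) = envel_quo (arens_lact Psi Xi').
Proof.
move=> XiE; apply: dualE => -[phi wphi]; rewrite /=; congr (Psi _).
by apply: dualE => a; apply: (envel_quo_eqP XiE); exact: wap_ract.
Qed.

(** The elements a . phi, for a running along a bounded net with weak* limit Psi,
    have a weak limit by weak compactness, and pairing with X identifies it. *)
Lemma arens_rpair_weak_limit (Psi : dual (dual (regular A))) (phi : dual X) :
  weakly_compact (fun a : A => lact a phi) ->
  exists2 F : set_system A, UltraFilter F &
    forall Xi, Xi (lact a phi) @[a --> F] --> Xi (arens_rpair Psi phi).
Proof.
move=> wphi; have [F UF [FM FPsi]] := goldstine Psi; exists F => //.
have [|y Fy] := weakly_compact_bounded_ultra (@lact_linearl _ A (dual X) phi) _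
  wphi UF FM.
  by rewrite ltr_wpDl.
suff -> : arens_rpair Psi phi = y by [].
apply: dualE => x; apply: (scalar_cvg_unique _ (Fy (bidual_emb x))).
exact: (FPsi (arens_xpair phi x)).
Qed.

Lemma arens_ract_quo (Psi : dual (dual (regular A))) Xi Xi' :
  envel_quo Xi = envel_quo Xi' ->
  envel_quo (arens_ract Xi Psi) = envel_quo (arens_ract Xi' Psi).
Proof.
move=> XiE; apply: dualE => -[phi wphi] /=.
have /asboolP[phil _] := wphi.
have [F UF Fphi] := arens_rpair_weak_limit Psi phil.
apply: (scalar_cvg_unique (Fphi Xi)).
rewrite (_ : (fun a => Xi _) = fun a => Xi' (lact a phi)); first exact: Fphi.
by apply/funext => a; apply: (envel_quo_eqP XiE); exact: wap_lact.
Qed.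

End EnvelLift.

(** * The extension of a derivation *)

Section DerivationAdjoint.
Variables (R : realType) (A : banachAlgType R[i]) (X : contrBimodType A).
Variable D : regular A -> X.
Hypotheses (lD : linear D) (cD : continuous D)
  (dD : derivation bmul lact ract (D : A -> X)).

Let bD := linear_continuous_bound lD cD.
Let D' : dual X -> dual (regular A) := adjoint lD bD.
Let D'' : dual (dual (regular A)) -> dual (dual X) :=
  adjoint (@adjoint_map_linear _ _ _ _ lD bD)
    (linear_continuous_bound (@adjoint_map_linear _ _ _ _ lD bD)
      (@adjoint_map_continuous _ _ _ _ lD bD)).

Lemma lact_orbit_bound (x : X) :
  exists2 M, 0 <= M & forall a : regular A, `|lact (a : A) x| <= M * `|a|.
Proof. by exists `|x| => // a; rewrite mulrC lact_norm. Qed.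

(** b |-> phi (b . x), the left counterpart of arens_xpair *)
Let lpair (phi : dual X) (x : X) : dual (regular A) :=
  adjoint (@lact_linearl _ A X x : linear (fun a : regular A => lact (a : A) x))
   (lact_orbit_bound x) phi.

Let D'_lact a phi : lact a (D' phi) = D' (lact a phi) + lpair phi (D a).
Proof.
by apply: dualE => b; rewrite /= [D _]dD dualD addrC.
Qed.

Let D'_ract a phi : ract (D' phi) a = D' (ract phi a) + arens_xpair phi (D a).
Proof. by apply: dualE => b; rewrite /= [D _]dD dualD. Qed.

(** In each orbit map of D' phi one summand comes from the orbit map of phi on the
    same side, the other by transposition from the one on the opposite side. *)
Lemma derivation_adjoint_wap phi : phi \in @wap_pred R A (dual X) ->
  D' phi \in @wap_pred R A (dual (regular A)).
Proof.
move=> /asboolP[phil phir]; apply/asboolP; split.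
- rewrite (_ : (fun a => _) = fun a => 1 *: D' (lact a phi) + lpair phi (D a)).
    apply: weakly_compactZD.
      by apply: weakly_compact_comp phil;
        [exact: adjoint_map_linear|exact: adjoint_map_continuous].
    apply: (weakly_compact_precomp lD cD).
      by move=> k x y; apply: dualE => a; rewrite /= lact_linearr dual_linear.
    apply: weakly_compact_transpose phir => //; first exact: ract_linearr.
    exact: ract_continuousr.
  by apply/funext => a; rewrite scale1r -D'_lact.
- rewrite (_ : (fun a => _) =
      fun a => 1 *: D' (ract phi a) + arens_xpair phi (D a)).
    apply: weakly_compactZD.
      by apply: weakly_compact_comp phir;
        [exact: adjoint_map_linear|exact: adjoint_map_continuous].
    apply: (weakly_compact_precomp lD cD).
      by move=> k x y; apply: dualE => a; rewrite /= ract_linearl dual_linear.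
    apply: weakly_compact_transpose phil => //; first exact: lact_linearl.
    exact: lact_continuousl.
  by apply/funext => a; rewrite scale1r -D'_ract.
Qed.

(** Transposing D'_ract gives
      arens_lpair Psi (D' phi)
        = arens_lpair (D'' Psi) phi + D' (arens_rpair Psi phi)
    in A^*, to which Phi is applied. *)
Lemma derivation_arens Phi Psi :
  D'' (arens_lact Phi Psi) = arens_lact Phi (D'' Psi) + arens_ract (D'' Phi) Psi.
Proof.
apply: dualE => phi.
transitivity (Phi (arens_lpair (D'' Psi) phi + D' (arens_rpair Psi phi))).
  congr (Phi _); apply: dualE => a.
  transitivity (Psi (D' (ract phi a) + arens_xpair phi (D a))).
    by rewrite -D'_ract.
  by rewrite dualD.
by rewrite dualD.
Qed.

Definition derivation_envel_pre (w : wap (dual X)) : wap (dual (regular A)) :=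
  Wap (derivation_adjoint_wap (valP w)).

Lemma derivation_envel_pre_linear : linear derivation_envel_pre.
Proof.
move=> k v w; apply: val_inj; rewrite [RHS]wap_val_linear.
exact: (adjoint_map_linear lD bD k (wap_val v) (wap_val w)).
Qed.

Lemma derivation_envel_pre_bound : exists2 M, 0 <= M &
  forall w, `|derivation_envel_pre w| <= M * `|w|.
Proof.
have [M M0 MD] := linear_continuous_bound (@adjoint_map_linear _ _ _ _ lD bD)
      (@adjoint_map_continuous _ _ _ _ lD bD).
by exists M => // w; exact: MD.
Qed.

Definition derivation_envel : envel (regular A) -> envel X :=
  adjoint derivation_envel_pre_linear derivation_envel_pre_bound.

Lemma derivation_envel_quo Phi :
  derivation_envel (envel_quo Phi) = envel_quo (D'' Phi).
Proof. exact: dualE. Qed.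

Lemma derivation_envel_eta a : derivation_envel (envel_eta a) = envel_eta (D a).
Proof. exact: dualE. Qed.

Lemma derivation_envel_derivation :
  derivation (@envel_mul R A) (@envel_lact R A X) (@envel_ract R A X)
    derivation_envel.
Proof.
move=> Phi Psi; rewrite /envel_mul derivation_envel_quo derivation_arens.
have lift Xi : envel_quo (envel_lift (derivation_envel Xi)) =
    envel_quo (D'' (envel_lift Xi)).
  by rewrite envel_liftK -derivation_envel_quo envel_liftK.
rewrite /envel_lact /envel_ract.
rewrite (arens_lact_quo _ (lift Psi)) (arens_ract_quo _ (lift Phi)).
exact: dualE.
Qed.

End DerivationAdjoint.

Lemma weakstar_continuous_eta_eq (R : realType) (A : banachAlgType R[i])
  (X : contrBimodType A) (W : normedModType R[i]) (S T : envel X -> dual W) :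
  weakstar_continuous S -> weakstar_continuous T ->
  (forall x : X, S (envel_eta x) = T (envel_eta x)) -> S = T.
Proof.
move=> cS cT ST; apply/funext => Phi; apply: dualE => w.
have [F UF FPhi] := envel_eta_dense Phi.
have lim (Q : envel X -> dual W) : weakstar_continuous Q ->
    Q (envel_eta x) w @[x --> F] --> Q Phi w.
  by move=> /weakstar_continuousP cQ; exact: (cQ (envel_eta (X := X) @ F)).
apply: (scalar_cvg_unique (lim S cS)).
under eq_fun do rewrite ST.
exact: lim.
Qed.

Theorem theorem4p4 (R : realType) (A : banachAlgType R[i])
    (X : banachBimodType A) (D : A -> X) :
  linear D -> continuous D -> derivation bmul lact ract D ->
  exists! Dt : envel (regular A) -> envel X,
    [/\ linear Dt,
        continuous Dt,
        weakstar_continuous Dt,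
        derivation (@envel_mul R A) (@envel_lact R A X) (@envel_ract R A X) Dt
      & forall a : A,
          Dt (@envel_eta R A (regular A) a) = @envel_eta R A X (D a)].
Proof.
move=> lD cD dD.
exists (derivation_envel lD cD dD); split=> [|Dt [_ _ wDt _ etaDt]].
  split.
  - exact: adjoint_map_linear.
  - exact: adjoint_map_continuous.
  - exact: adjoint_weakstar_continuous.
  - exact: derivation_envel_derivation.
  - exact: derivation_envel_eta.
apply: weakstar_continuous_eta_eq => //.
  exact: adjoint_weakstar_continuous.
by move=> a; rewrite etaDt; exact: derivation_envel_eta.
Qed.
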